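(* For every odd integer $m\ge 3$, there exists a self-dual regular $3$-polytope with Schläfli type $\{m,m\}$ having exactly $2^m m$ flags.
   Context: An abstract polytope of rank $d$ (a $d$-polytope) is a partially ordered set $\mathcal{P}$ with a strictly order-preserving rank function $\mathrm{rank}:\mathcal{P}\to\{-1,0,\ldots,d\}$ such that: (i) $\mathcal{P}$ has a unique minimal element $F_{-1}$ (of rank $-1$) and a unique maximal element $F_d$ (of rank $d$); (ii) every maximal totally ordered subset (called a flag) contains exactly $d+2$ elements, including $F_{-1}$ and $F_d$; (iii) (diamond condition) whenever $F<G$ in $\mathcal{P}$ with $\mathrm{rank}(G)-\mathrm{rank}(F)=2$, there are exactly two elements $H$ with $F<H<G$; (iv) (strong connectivity) any two flags $\Phi,\Psi$ can be joined by a sequence of flags $\Phi=\Phi_0,\Phi_1,\ldots,\Phi_k=\Psi$ such that consecutive flags differ in exactly one element and every $\Phi_i$ contains $\Phi\cap\Psi$. An element of rank $i$ is called an $i$-face. An automorphism of $\mathcal{P}$ is an order-preserving bijection $\mathcal{P}\to\mathcal{P}$ that preserves the partial order structure (its inverse is also order-preserving) and the ranks; the group of automorphisms is $\mathrm{Aut}(\mathcal{P})$. The polytope $\mathcal{P}$ is regular if $\mathrm{Aut}(\mathcal{P})$ acts transitively on flags. For a regular $d$-polytope with a fixed base flag $\Phi$, let $\rho_i\in\mathrm{Aut}(\mathcal{P})$ ($0\le i\le d-1$) be the automorphism mapping $\Phi$ to the unique flag differing from $\Phi$ exactly in the $i$-face; the (Schläfli) type of $\mathcal{P}$ is $\{p_1,\ldots,p_{d-1}\}$,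 where $p_i$ is the order of $\rho_{i-1}\rho_i$. The dual $\mathcal{P}^*$ is obtained from $\mathcal{P}$ by reversing the partial order, and $\mathcal{P}$ is self-dual if $\mathcal{P}\cong\mathcal{P}^*$. *)

(* Defs.v *)
From HB Require Import structures.
From mathcomp Require Import all_boot all_order all_algebra all_fingroup.

Set Implicit Arguments.
Unset Strict Implicit.
Unset Printing Implicit Defensive.

Import Order.TTheory GRing.Theory Num.Theory.

Local Open Scope order_scope.

Section Posets.
Variables (disp : Order.disp_t) (T : finPOrderType disp).
Implicit Types (A B : {set T}) (F G : T).

Definition chain A : bool :=
  [forall F in A, forall G in A, F >=< G].

Definition is_flag A : bool := maxset chain A.

Definition differ_in_one A B : bool :=
  (#|A :\: B| == 1)%N && (#|B :\: A| == 1)%N.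

Record is_polytope (d : nat) (rank : T -> int) (Fmin Fmax : T) : Prop :=
  IsPolytope {
    rank_range : forall F, (- 1 <= rank F)%R /\ (rank F <= d%:Z)%R;
    rank_strict : forall F G, F < G -> (rank F < rank G)%R;
    rank_Fmin : rank Fmin = (- 1)%R;
    rank_Fmax : rank Fmax = (d%:Z)%R;
    unique_minimal : forall F, (forall G, ~~ (G < F)) <-> F = Fmin;
    unique_maximal : forall F, (forall G, ~~ (F < G)) <-> F = Fmax;
    flag_size : forall A, is_flag A ->
      [/\ #|A| = d.+2, Fmin \in A & Fmax \in A];
    diamond : forall F G, F < G -> (rank G - rank F = 2%:Z)%R ->
      #|[set H : T | F < H < G]| = 2%N;
    strongly_connected : forall A B, is_flag A -> is_flag B ->
      exists s : seq {set T},
        [/\ path differ_in_one A s, last A s = B &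
            all (fun C => is_flag C && (A :&: B \subset C)) s]
  }.

End Posets.

(* The posets are finite: a polytope with finitely many flags has finitely    *)
(* many faces, since every face lies on a flag.                               *)
Structure polytope (d : nat) : Type := Polytope {
  face_display : Order.disp_t;
  face :> finPOrderType face_display;
  rank : face -> int;
  Fmin : face;
  Fmax : face;
  polytopeP : is_polytope d rank Fmin Fmax
}.

Arguments rank {d} P F : rename.
Arguments Fmin {d} P : rename.
Arguments Fmax {d} P : rename.

Section Dual.

Lemma chain_dual disp (T : finPOrderType disp) (A : {set T}) :
  @chain _ (T^d) A = chain A.
Proof.
by apply: eq_forallb => F; congr (_ ==> _); apply: eq_forallb => G;
   congr (_ ==> _); rewrite /Order.comparable orbC.
Qed.

Lemma is_flag_dual disp (T : finPOrderType disp) (A : {set T}) :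
  @is_flag _ (T^d) A = is_flag A.
Proof. exact: (maxset_eq A (@chain_dual _ T)). Qed.

Lemma dual_polytopeP d (P : polytope d) :
  @is_polytope _ (P^d) d
    (fun F : P^d => (d%:Z - 1 - rank P F)%R) (Fmax P) (Fmin P).
Proof.
have [rr rs r0 r1 um uM fs di sc] := polytopeP P.
split.
- move=> F; have [h1 h2] := rr F; split.
    by rewrite [X in (_ <= X)%R]addrAC lerBrDr addNr subr_ge0.
  by rewrite -addrA gerDl -opprD oppr_le0 -lerBlDl sub0r.
- by move=> F G /rs h; rewrite ltrD2l ltrN2.
- by rewrite r1 addrAC subrr add0r.
- by rewrite r0 opprK subrK.
- exact: uM.
- exact: um.
- by move=> A; rewrite is_flag_dual => /fs [-> -> ->].
- move=> F G ltGF e; rewrite -(di G F ltGF).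
    by apply: eq_card => H; rewrite !inE andbC.
  by rewrite -e opprB [RHS]addrC addrA subrK.
- move=> A B; rewrite !is_flag_dual => fA fB.
  have [s [ps ls /allP as_]] := sc A B fA fB; exists s; split => //.
  by apply/allP => C /as_; rewrite is_flag_dual.
Qed.

Definition dual d (P : polytope d) : polytope d :=
  Polytope (dual_polytopeP P).

End Dual.

(* For a bijective [f] the order condition says that [f] and its inverse are  *)
(* both order-preserving.                                                     *)
Definition preserves_faces d (P Q : polytope d) (f : P -> Q) : bool :=
  [forall F, forall G, (f F <= f G) == (F <= G)]
  && [forall F, rank Q (f F) == rank P F].

Definition isomorphic d (P Q : polytope d) : Prop :=
  exists2 f : P -> Q, bijective f & preserves_faces f.

Definition self_dual d (P : polytope d) : Prop := isomorphic P (dual P).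

Section Symmetry.
Variables (d : nat) (P : polytope d).

Definition flags : {set {set P}} := [set A : {set P} | is_flag A].

Definition automorphisms : {set {perm P}} :=
  [set s : {perm P} | preserves_faces (s : P -> P)].

Lemma automorphisms_group_set : group_set automorphisms.
Proof.
apply/group_setP; split.
  by rewrite inE; apply/andP; split; apply/forallP => F;
     [apply/forallP => G|]; rewrite !perm1.
move=> s t; rewrite !inE => /andP[/forallP so /forallP sr].
move=> /andP[/forallP to /forallP tr]; apply/andP; split; apply/forallP => F.
  apply/forallP => G; rewrite !permM.
  by rewrite (eqP (forallP (to _) _)) (eqP (forallP (so _) _)).
by rewrite permM (eqP (tr _)) (eqP (sr _)).
Qed.

Canonical automorphisms_group : {group {perm P}} :=
  Group automorphisms_group_set.

Definition regular : Prop := [transitive automorphisms, on flags | 'P^*].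

Definition differ_exactly_at (i : nat) (A B : {set P}) : bool :=
  (A != B) && [forall F, ((F \in A) != (F \in B)) ==> (rank P F == i%:Z)%R].

Definition base_generators (A : {set P}) (rho : nat -> {perm P}) : Prop :=
  forall i, (i < d)%N ->
    [/\ rho i \in automorphisms,
        'P^*%act A (rho i) \in flags &
        differ_exactly_at i A ('P^*%act A (rho i))].

(* The sequence [p] lists p_1, ..., p_(d-1), so its entry of index i, which   *)
(* is p_(i+1), is the order of rho_i rho_(i+1).  For a regular polytope the   *)
(* base flag is immaterial, and every choice of it is required to give [p].   *)
Definition has_schlafli_type (p : seq nat) : Prop :=
  forall A, A \in flags ->
    exists2 rho : nat -> {perm P}, base_generators A rho &
      p = [seq #[rho i * rho i.+1]%g | i <- iota 0 d.-1].

End Symmetry.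

(* Main.v *)
From HB Require Import structures.
From mathcomp Require Import all_boot all_order all_algebra all_fingroup.
From mathcomp Require Import cyclic.
Require Import Defs.

Set Implicit Arguments.
Unset Strict Implicit.
Unset Printing Implicit Defensive.

Import Order.TTheory GRing.Theory Num.Theory.

(** Take the cube graph on the vectors of F_2^m, and call the square with
    corner x spanned by the unit vectors e_i, e_(i+1) (indices in Z/m) a
    consecutive square.  Vertices, edges and consecutive squares form a regular
    map of type {4,m} whose graph is bipartite, by parity of the vectors.
    Halving that map gives the polytope: its vertices are the even vectors, its
    edges are the diagonals {x, x + e_i + e_(i+1)} of the consecutive squares
    that join even vectors, and its 2-faces are the m-gons formed by the m cube
    neighbours of an odd vector y.  For m = 3 this is the tetrahedron inscribed
    in the 3-cube.  Every face is encoded as its set of vertices, ordered by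
    inclusion, with rank read off from the cardinality 0, 1, 2, m or 2^(m-1).

    A flag amounts to an even vector x with an arc (i, j = i + 1 or i - 1) of
    the m-cycle: its edge is {x, x + e_i + e_j} and its 2-face is centred at
    x + e_i.  There are 2^(m-1) * m * 2 such codes, and the three flag
    adjacencies become
      (x; i, j) -> (x + e_i + e_j; j, i),  (x; i, 2i - j),  (x; j, i).
    The geometry rests on [ebit3]: e_i + e_j + e_k, with i and j distinct, is a
    unit vector only if k is i or j; in other words, two vectors at distance 2
    in the cube have only two common neighbours.  It yields that
    incident faces lie in a common flag ([common_code]), the diamond condition
    ([between_codes]) and the description of the flags on an edge
    ([edge_codes]).  Strong
    connectivity ([strong_conn]) follows from two facts: the arcs of the
    m-cycle are connected under reversing an arc and turning it about its
    origin, and the vectors e_i + e_(i+1) generate the even vectors.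

    Even translations combined with the dihedral group of the m-cycle act
    transitively on codes ([transport]), whence regularity.  With respect to
    the code (x; i, j), the generators rho_0, rho_1, rho_2 are the reflections
    of the coordinates about the points x + e_i, x, x; since rho_1 fixes
    x + e_i too, both rho_0 rho_1 and rho_1 rho_2 are one-step cyclic shifts
    of the coordinates about a common fixed point, of order m ([order_rot]).
    Finally, sending a set of vertices to its set of common cube neighbours is
    a Galois connection that maps {x} to an m-gon, an edge to the other
    diagonal of its square, and an m-gon to its centre; following it by the
    translation by e_0, which restores the parity, gives a duality
    ([polar_cell]). *)

(** * Maximal chains in a graded poset *)

Section GradedChains.
Local Open Scope order_scope.
Variables (disp : Order.disp_t) (T : finPOrderType disp) (rk : T -> nat).
Hypothesis rk_strict : forall F G : T, F < G -> (rk F < rk G)%N.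
Implicit Types (A : {set T}) (F G H : T).

Lemma chainP A : reflect {in A &, forall F G, F >=< G} (chain A).
Proof.
apply: (iffP forall_inP) => [cA F G FA GA | cA F FA].
  exact: (forall_inP (cA F FA)).
by apply/forall_inP => G GA; apply: cA.
Qed.

Lemma chain_rank_le A F G : chain A -> F \in A -> G \in A ->
  (rk F <= rk G)%N -> F <= G.
Proof.
move=> /chainP cA FA GA le_FG; have /orP[// | le_GF] := cA F G FA GA.
case: (eqVneq F G) => [-> // | neq].
have /rk_strict : G < F by rewrite lt_neqAle eq_sym neq.
by rewrite ltnNge le_FG.
Qed.

Lemma chain_rank_inj A F G : chain A -> F \in A -> G \in A ->
  rk F = rk G -> F = G.
Proof.
move=> cA FA GA eq_r; apply: le_anti.
by rewrite !(@chain_rank_le A) ?eq_r.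
Qed.

Lemma full_chain_flag A : chain A ->
  (forall G, exists2 F, F \in A & rk F = rk G) -> is_flag A.
Proof.
move=> cA full; apply/maxsetP; split=> // B cB sAB; apply/eqP.
rewrite eqEsubset sAB andbT; apply/subsetP => G GB.
have [F FA eq_r] := full G.
by rewrite -(@chain_rank_inj B F G) // (subsetP sAB).
Qed.

Lemma flag_comparable A F : is_flag A -> {in A, forall G, F >=< G} -> F \in A.
Proof.
move=> /maxsetP[/chainP cA maxA] cF.
rewrite -(maxA (F |: A)) ?setU11 ?subsetU1 //; apply/chainP.
move=> G H /setU1P[-> | GA] /setU1P[-> | HA].
- exact: comparablexx.
- exact: cF.
- by rewrite comparable_sym; apply: cF.
- exact: cA.
Qed.

(** A flag that contains F also meets the next rank: the face H that the
    filling hypothesis puts between F and the lowest element of the flag above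
    F is comparable with the whole flag, so it belongs to it by maximality. *)
Lemma flag_next A F M : is_flag A -> F \in A -> (forall G, G <= M) ->
    (forall G, F < G -> exists H, [/\ F < H, H <= G & rk H = (rk F).+1]) ->
  (rk F < rk M)%N -> exists2 H, H \in A & rk H = (rk F).+1.
Proof.
move=> flagA FA leM fill lt_FM.
have cA : chain A by case/maxsetP: flagA.
have MA : M \in A.
  by apply: flag_comparable => // G _; rewrite /Order.comparable leM orbT.
case: (@arg_minnP _ M [pred G | (G \in A) && (rk F < rk G)%N] rk).
  by rewrite /= MA.
move=> G /andP[GA lt_FG] minG.
have ltFG : F < G.
  rewrite lt_neqAle (chain_rank_le cA) ?andbT // 1?ltnW //.
  by apply: contraTneq lt_FG => ->; rewrite ltnn.
have [H [ltFH leHG rkH]] := fill G ltFG; exists H => //.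
apply: flag_comparable => // K KA; rewrite /Order.comparable.
have [le_KF | lt_FK] := leqP (rk K) (rk F).
  by rewrite (le_trans (chain_rank_le cA KA FA le_KF) (ltW ltFH)) orbT.
rewrite (le_trans leHG) // (chain_rank_le cA) //; apply: minG.
by rewrite /= KA.
Qed.

End GradedChains.

(** * Vectors over the two-element field *)

Section HalvedCube.
Local Open Scope ring_scope.

(* The cycle length is m = n + 3, so that 'I_n.+3 is the ring Z/m, in which
   1 and -1 differ; booleans with exclusive or form the field F_2. *)
Variable n : nat.

Local Notation idx := 'I_n.+3.
Local Notation vec := {ffun 'I_n.+3 -> bool}.

Implicit Types (i j k c : idx) (u v x y z : vec) (b : bool).

Definition ebit i : vec := [ffun k => k == i].

Lemma bitD u v k : (u + v) k = u k (+) v k.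
Proof. by rewrite ffunE. Qed.

Lemma addvv u : u + u = 0.
Proof. by apply/ffunP => k; rewrite !ffunE; case: (u k). Qed.

Lemma addvvK u v : u + v + v = u.
Proof. by rewrite -addrA addvv addr0. Qed.

Lemma addKvv u v : u + (u + v) = v.
Proof. by rewrite addrA addvv add0r. Qed.

Definition parity u : bool := \sum_k u k.

Lemma parityD u v : parity (u + v) = parity u (+) parity v.
Proof.
by rewrite /parity -[RHS]big_split; apply: eq_bigr => k _; rewrite bitD.
Qed.

Lemma parity_ebit i : parity (ebit i).
Proof.
rewrite /parity (bigD1 i) //= big1 => [|k /negPf nki]; rewrite ffunE ?nki //.
by rewrite eqxx.
Qed.

Definition evens : {set vec} := [set u | ~~ parity u].

(** A boolean encodes an orientation of the m-cycle. *)
Definition pm b : idx := if b then -1 else 1.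

Lemma pmN b : pm (~~ b) = - pm b.
Proof. by case: b; rewrite //= opprK. Qed.

Lemma pm_neq0 b : pm b != 0.
Proof. by case: b; rewrite //= oppr_eq0. Qed.

Lemma pm_inj : injective pm.
Proof.
have ne : 1 != -1 :> idx by rewrite -addr_eq0.
by case=> [] [] //= /eqP; rewrite ?(negPf ne) // eq_sym (negPf ne).
Qed.

Lemma pm_other b b' : b' != b -> b' = ~~ b.
Proof. by case: b b' => [] []. Qed.

Lemma addpm_neq i b : (i + pm b == i) = false.
Proof. by rewrite -subr_eq0 addrC addKr (negPf (pm_neq0 b)). Qed.

Lemma ebit_inj : injective ebit.
Proof. by move=> i j /ffunP/(_ i); rewrite !ffunE eqxx => /esym/eqP. Qed.

(** Were k different from i and j, the left-hand side would have three nonzero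
    coordinates. *)
Lemma ebit3 i j k c : i != j -> ebit i + ebit j + ebit k = ebit c ->
  k = i \/ k = j.
Proof.
move=> nij /ffunP eq_c; case: (eqVneq k i) => [-> | nki]; first by left.
case: (eqVneq k j) => [-> | nkj]; first by right.
have := eq_c i; have := eq_c j; have := eq_c k; rewrite !ffunE !eqxx.
rewrite (negPf nki) (negPf nkj) ![i == k]eq_sym ![j == k]eq_sym (negPf nki).
rewrite (negPf nkj) [j == i]eq_sym (negPf nij) /= => /esym/eqP <-.
by rewrite [j == k]eq_sym (negPf nkj).
Qed.

Lemma ebit2 i j k c : i != j -> ebit i + ebit j = ebit k + ebit c ->
  (k = i /\ c = j) \/ (k = j /\ c = i).
Proof.
move=> nij eq_s; have eq_c : ebit i + ebit j + ebit k = ebit c.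
  by rewrite eq_s addrAC addvv add0r.
have [ki | kj] := ebit3 nij eq_c; [left | right]; split=> //.
  by apply: ebit_inj; rewrite -eq_c ki addrAC addvv add0r.
by apply: ebit_inj; rewrite -eq_c kj addvvK.
Qed.

(** * Cube neighbours *)

Definition nbrs y : {set vec} := [set y + ebit i | i : idx].

Lemma nbrsP x y : reflect (exists i, x = y + ebit i) (x \in nbrs y).
Proof.
by apply: (iffP imsetP) => [[i _ ->] | [i ->]]; exists i.
Qed.

Lemma nbrs_sym x y : (x \in nbrs y) = (y \in nbrs x).
Proof.
by apply/nbrsP/nbrsP => -[i ->]; exists i; rewrite addvvK.
Qed.

Lemma card_nbrs y : #|nbrs y| = n.+3.
Proof.
rewrite card_imset ?card_ord // => i j /addrI; exact: ebit_inj.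
Qed.

Lemma common_nbrs x y i j : i != j ->
    x \in nbrs y -> x + (ebit i + ebit j) \in nbrs y ->
  y = x + ebit i \/ y = x + ebit j.
Proof.
rewrite nbrs_sym => nij /nbrsP[k ->] /nbrsP[c].
rewrite -!addrA => /addrI eq_c.
have [] := @ebit3 i j k c nij; first by rewrite eq_c addrAC addvv add0r.
  by move->; left.
by move->; right.
Qed.

(** A 2-face determines its centre: the second common neighbour of y + e_0 and
    y + e_1 is y + e_0 + e_1, which is at distance 3 from y + e_2. *)
Lemma nbrs_inj : injective nbrs.
Proof.
move=> y z eq_yz.
have yz k : y + ebit k \in nbrs z by rewrite -eq_yz; apply/nbrsP; exists k.
have n01 : 0 != 1 :> idx by [].
have h2 : y + ebit 0 + (ebit 0 + ebit 1) \in nbrs z.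
  by rewrite addrA addvvK yz.
have [-> | z_def] := common_nbrs n01 (yz 0) h2; first by rewrite addvvK.
have /nbrsP[c] := yz (1 + 1); rewrite z_def -!addrA => /addrI eq_c.
have [] := @ebit3 0 1 (1 + 1) c n01; last by [].
  by rewrite eq_c !addrA [ebit 0 + _ + _]addrAC addvv add0r addvv add0r.
by [].
Qed.

(** Translation by e_0 exchanges even and odd vectors. *)
Lemma card_evens : #|evens| = (2 ^ n.+2)%N.
Proof.
have flip : #|evens| = #|~: evens|.
  rewrite -(@card_imset _ _ (+%R (ebit 0))); last exact: addrI.
  apply: eq_card => u; rewrite !inE negbK; apply/imsetP/idP => [[v + ->] | pu].
    by rewrite inE parityD parity_ebit => /negPf->.
  exists (ebit 0 + u); last by rewrite addKvv.
  by rewrite inE parityD parity_ebit pu.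
have := cardsC evens; rewrite -flip addnn card_ffun card_bool card_ord.
by rewrite [(2 ^ n.+3)%N]expnS mul2n => /double_inj.
Qed.

(** * Faces of a flag and flag adjacency *)

(** The code (x, i, b) stands for the flag given by the vector x and the arc
    from i to i + pm b. *)
Definition code : Type := (vec * idx * bool)%type.
Implicit Types (phi psi chi : code).

(** The index r of a cell is its rank plus one, from the empty set up to the
    set of all vertices. *)
Definition cell phi (r : nat) : {set vec} :=
  let: (x, i, b) := phi in
  match r with
  | 0 => set0
  | 1 => [set x]
  | 2 => [set x; x + (ebit i + ebit (i + pm b))]
  | 3 => nbrs (x + ebit i)
  | _ => evens
  end.

Definition move (r : nat) phi : code :=
  let: (x, i, b) := phi in
  match r with
  | 1 => (x + (ebit i + ebit (i + pm b)), i + pm b, ~~ b)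
  | 3 => (x, i + pm b, ~~ b)
  | _ => (x, i, ~~ b)
  end.

(** Odd vectors are kept in [code] so that [move] is a plain function; only based
    codes give flags of the polytope. *)
Definition based phi : bool := phi.1.1 \in evens.

Lemma evensD2 x i j : (x + (ebit i + ebit j) \in evens) = (x \in evens).
Proof. by rewrite !inE !parityD !parity_ebit addbF. Qed.

Lemma based_move r phi : based (move r phi) = based phi.
Proof.
by case: phi r => [[x i] b] [|[|[|[|r]]]]; rewrite /based //= evensD2.
Qed.

Lemma pmK i b : i + pm b + pm (~~ b) = i.
Proof. by rewrite pmN addrK. Qed.

Lemma cell_succ phi r : based phi -> cell phi r \subset cell phi r.+1.
Proof.
case: phi => [[x i] b]; rewrite /based /= => ex.
case: r => [|[|[|[|r]]]] //=.
- exact: sub0set.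
- by rewrite sub1set set21.
- rewrite subUset !sub1set; apply/andP; split; apply/nbrsP.
    by exists i; rewrite addvvK.
  by exists (i + pm b); rewrite addrA.
- by apply/subsetP => _ /nbrsP[j ->]; rewrite -addrA evensD2.
Qed.

Lemma cell_mono phi r s :
  based phi -> (r <= s)%N -> cell phi r \subset cell phi s.
Proof.
move=> b_phi; elim: s => [|s IH]; first by rewrite leqn0 => /eqP->.
rewrite leq_eqVlt => /predU1P[-> // | /IH sub].
exact: subset_trans sub (cell_succ s b_phi).
Qed.

(** The number of cells of a flag with fewer elements than A, according to the
    cardinalities in [card_cell]. *)
Definition cardrank (A : {set vec}) : nat :=
  (0 < #|A|) + (1 < #|A|) + (2 < #|A|) + (n.+3 < #|A|).

Lemma edge_neq i b : ebit i + ebit (i + pm b) != 0.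
Proof.
apply/eqP => eq0; have := addpm_neq i b; rewrite -(inj_eq ebit_inj).
by rewrite -[ebit i]addr0 -eq0 addKvv eqxx.
Qed.

Lemma card_cell phi r : (r < 5)%N ->
  #|cell phi r| = nth 0 [:: 0; 1; 2; n.+3; 2 ^ n.+2]%N r.
Proof.
case: phi => [[x i] b]; case: r => [|[|[|[|[|r]]]]] //= _.
- by rewrite cards0.
- by rewrite cards1.
- by rewrite cards2 -{1}[x]addr0 (inj_eq (addrI x)) eq_sym edge_neq.
- exact: card_nbrs.
- exact: card_evens.
Qed.

Lemma lt_expn2 : (n.+3 < 2 ^ n.+2)%N.
Proof.
elim: n => // k IH; rewrite expnS mul2n -addnn -addn1.
by rewrite leq_add // expn_gt0.
Qed.

Lemma cardrank_cell phi r : (r < 5)%N -> cardrank (cell phi r) = r.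
Proof.
move=> lt_r5; rewrite /cardrank card_cell //.
have := lt_expn2; case: r lt_r5 => [|[|[|[|[|r]]]]] //= _; rewrite ?ltnn //.
by move=> h; rewrite h !(leq_ltn_trans _ h).
Qed.

Lemma cell_eq phi psi r : (r < 5)%N -> cell phi r \subset cell psi r ->
  cell phi r = cell psi r.
Proof.
by move=> lt_r5 sub; apply/eqP; rewrite eqEcard sub !card_cell ?leqnn.
Qed.

Lemma cell_move phi r s : (0 < r < 4)%N -> s != r ->
  cell (move r phi) s = cell phi s.
Proof.
case: phi => [[x i] b]; case: r => [|[|[|[|[|r]]]]] //= _;
  case: s => [|[|[|[|[|s]]]]] //= _; rewrite ?pmK //.
- by rewrite [ebit (i + _) + _]addrC addvvK setUC.
- by rewrite addrA addvvK.
- by rewrite [ebit (i + _) + _]addrC.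
Qed.

Lemma cell_moveN phi r : (0 < r < 4)%N -> cell (move r phi) r != cell phi r.
Proof.
case: phi => [[x i] b]; case: r => [|[|[|[|[|r]]]]] //= _.
- rewrite (inj_eq set1_inj) -[X in _ != X]addr0 (inj_eq (addrI x)).
  exact: edge_neq.
- apply/eqP => /setP/(_ (x + (ebit i + ebit (i + pm b)))).
  rewrite !inE eqxx orbT.
  rewrite -[X in _ == X]addr0 !(inj_eq (addrI x)) (negPf (edge_neq i b)).
  rewrite (inj_eq (addrI _)) (inj_eq ebit_inj) (inj_eq (addrI i)).
  by rewrite (inj_eq pm_inj); case: (b).
- by rewrite (inj_eq nbrs_inj) (inj_eq (addrI x)) (inj_eq ebit_inj) addpm_neq.
Qed.

(** * Incidence of faces *)

Lemma vertex_of_edge phi x : x \in cell phi 2 ->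
  exists2 psi, psi = phi \/ psi = move 1 phi & psi.1.1 = x.
Proof.
case: phi => [[z i] b]; rewrite !inE => /orP[] /eqP ->.
  by exists (z, i, b); first left.
by exists (move 1 (z, i, b)); first right.
Qed.

Lemma face_of_edge phi y : cell phi 2 \subset nbrs y ->
  exists2 psi, psi = phi \/ psi = move 3 phi & nbrs y = cell psi 3.
Proof.
case: phi => [[z i] b]; rewrite subUset !sub1set => /andP[h1 h2].
have nij : i != i + pm b by rewrite eq_sym addpm_neq.
have [-> | ->] := common_nbrs nij h1 h2.
  by exists (z, i, b); first left.
by exists (move 3 (z, i, b)); first right.
Qed.

Lemma arc_of_edge phi psi : phi.1.1 = psi.1.1 -> cell phi 2 = cell psi 2 ->
  phi = psi \/ phi = move 3 psi.
Proof.
case: phi psi => [[x i] b] [[z j] c] /= -> /setP eq_e.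
have := eq_e (z + (ebit i + ebit (i + pm b))).
rewrite !inE eqxx orbT -[X in _ == X]addr0 !(inj_eq (addrI z)).
rewrite (negPf (edge_neq i b)) /= => /esym/eqP eq_s.
have nij : i != i + pm b by rewrite eq_sym addpm_neq.
have [[-> /addrI eq_pm] | [-> eqi]] := ebit2 nij eq_s.
  by left; rewrite (pm_inj eq_pm).
right; rewrite /= eqi; congr (_, _, _); apply: pm_inj; rewrite pmN.
by apply/eqP; rewrite -addr_eq0 -(inj_eq (addrI i)) addrA eqi addr0.
Qed.

(** An edge lies on four flags: the ones with its two vertices and its two
    2-faces. *)
Lemma edge_codes phi psi : cell phi 2 = cell psi 2 ->
  [\/ psi = phi, psi = move 1 phi, psi = move 3 phi
    | psi = move 3 (move 1 phi)].
Proof.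
move=> eq_e.
have [|chi def_chi eq_x] := @vertex_of_edge phi psi.1.1.
  by rewrite eq_e; case: (psi) => [[x i] b]; rewrite !inE eqxx.
have eq_chi : cell chi 2 = cell psi 2.
  by case: def_chi => ->; rewrite ?cell_move.
have [] := arc_of_edge (esym eq_x) (esym eq_chi) => ->;
  by case: def_chi => ->; constructor.
Qed.

Lemma code_inj phi psi : (forall r, (0 < r < 4)%N -> cell phi r = cell psi r) ->
  phi = psi.
Proof.
move=> eq_c; have /set1_inj eq_x : [set phi.1.1] = [set psi.1.1].
  by have := eq_c 1%N isT; case: (phi) (psi) => [[? ?] ?] [[? ?] ?].
have [// | def] := arc_of_edge eq_x (eq_c 2 isT).
by have := cell_moveN psi (isT : 0 < 3 < 4)%N; rewrite -def eq_c ?eqxx.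
Qed.

(** This is what makes the incidence of two faces a statement about a single
    code.  Only the pairs vertex-edge, vertex-polygon and edge-polygon need an
    argument, and each time the code of one face is modified to fit the
    other. *)
Lemma common_code phi psi r s : (r <= s < 5)%N -> based phi -> based psi ->
    cell phi r \subset cell psi s ->
  exists chi, [/\ based chi, cell chi r = cell phi r & cell chi s = cell psi s].
Proof.
case: (ltngtP r s) => //= [lt_rs | <- lt_r5 b1 b2 /cell_eq eq_c]; last first.
  by exists phi; rewrite eq_c.
have cell0 chi : cell chi 0 = set0 by case: chi => [[]].
have cell4 chi : cell chi 4 = evens by case: chi => [[]].
case: r lt_rs => [|r] lt_rs lt_s5 b1 b2; first by exists psi; rewrite !cell0.
case: s lt_rs lt_s5 => [|[|[|[|[|s]]]]] // lt_rs _;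
  last by exists phi; rewrite !cell4.
all: case: r lt_rs => [|[|r]] // _.
- case: phi b1 => [[x i] b] _ /=; rewrite sub1set => h.
  have [chi def_chi eq_x] := @vertex_of_edge psi x h.
  exists chi; split; last by case: def_chi => ->; rewrite ?cell_move.
    by case: def_chi => ->; rewrite ?based_move.
  by case: (chi) eq_x => [[? ?] ?] /= ->.
- case: phi psi b1 b2 => [[x i] b] [[z j] c] b1 b2 /=.
  rewrite sub1set => /nbrsP[k ->]; exists (z + ebit j + ebit k, k, b).
  by rewrite /= addvvK -addrA /based evensD2.
- case: (psi) => [[z j] c] /face_of_edge[chi def_chi eq_y]; exists chi.
  split; last by rewrite /= eq_y.
    by case: def_chi => ->; rewrite ?based_move.
  by case: def_chi => ->; rewrite ?cell_move.
Qed.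

(** This is the diamond condition in terms of codes.  An edge lies in at most two
    2-faces by [common_nbrs]; and an edge at x inside the 2-face centred at
    x + e_i must involve the index i, which leaves two arcs. *)
Lemma between_codes chi psi r : (0 < r < 4)%N ->
    cell chi r.-1 \subset cell psi r -> cell psi r \subset cell chi r.+1 ->
  cell psi r = cell chi r \/ cell psi r = cell (move r chi) r.
Proof.
case: chi psi => [[z j] c] [[x i] b]; case: r => [|[|[|[|r]]]] //= _.
- by rewrite sub1set !inE => _ /orP[] /eqP->; [left | right].
- rewrite sub1set => h1 h2.
  have [chi def_chi eq_z] := @vertex_of_edge (x, i, b) z h1.
  have eq_e : cell chi 2 = cell (x, i, b) 2.
    by case: def_chi => ->; rewrite ?cell_move.
  have /face_of_edge[om def_om eq_y] : cell chi 2 \subset nbrs (z + ebit j).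
    by rewrite eq_e.
  (* The edge is rewritten with the code om that has the vertex z and the
     2-face of (z, j, c); then om and (z, j, c) share z and j. *)
  suff : cell (x, i, b) 2 = cell (z, j, c) 2 \/
         cell (x, i, b) 2 = cell (move 2 (z, j, c)) 2 by [].
  have {eq_e}<- : cell om 2 = cell (x, i, b) 2.
    by rewrite -eq_e; case: def_om => ->; rewrite ?cell_move.
  have : om.1.1 = z by case: def_om => ->; case: (chi) eq_z => [[]].
  case: (om) eq_y => [[w k] d] /= /nbrs_inj + eq_w.
  rewrite eq_w => /addrI/ebit_inj <-.
  by have [-> | /pm_other ->] := eqVneq d c; [left | right].
- move=> h _; have [chi def_chi ->] := @face_of_edge (z, j, c) _ h.
  by case: def_chi => ->; [left | right].
Qed.

(** * Connectivity of the flags *)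

Section Connection.

(** K is the set of the cell indices that must not change. *)
Definition step (K : pred nat) phi psi :=
  [exists r : 'I_4, [&& (0 < r)%N, ~~ K r & psi == move r phi]].

Local Notation conn K := (connect (step K)).

Lemma conn_move (K : pred nat) r phi :
  (0 < r < 4)%N -> ~~ K r -> conn K phi (move r phi).
Proof.
case/andP=> r_gt0 lt_r4 nKr; apply: connect1; apply/existsP.
by exists (Ordinal lt_r4); rewrite r_gt0 nKr /=.
Qed.

(** Flags around a fixed vertex and flags around a fixed 2-face both form a
    copy [emb] of the arcs of the m-cycle, on which move 2 turns an arc about
    its origin and another move t reverses it.  A reversal followed by a turn
    takes (i, i + 1) to (i + 1, i + 2), so one can walk around the cycle. *)
Lemma conn_arcs K t (emb : idx -> bool -> code) :
    (0 < t < 4)%N -> ~~ K t -> ~~ K 2%N ->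
    (forall i b, move 2 (emb i b) = emb i (~~ b)) ->
    (forall i b, move t (emb i b) = emb (i + pm b) (~~ b)) ->
  forall i b j b', conn K (emb i b) (emb j b').
Proof.
move=> t_ok nKt nK2 emb2 embt i b j b'.
have turn k d d' : conn K (emb k d) (emb k d').
  have [-> | /pm_other ->] := eqVneq d' d; first exact: connect0.
  by rewrite -emb2; apply: conn_move.
have walk d d' : conn K (emb i false) (emb (i + d%:R) d').
  elim: d d' => [|d IH] d'; first by rewrite addr0; apply: turn.
  apply: connect_trans (turn _ true d').
  apply: connect_trans (IH false) _.
  have := conn_move (emb (i + d%:R) false) t_ok nKt.
  by rewrite embt /= -addrA natr1.
apply: connect_trans (turn i b false) _.
by have := walk (val (j - i)) b'; rewrite natr_Zp addrC subrK.
Qed.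

Lemma conn_vertex K x : ~~ K 2%N -> ~~ K 3%N ->
  forall i b j b', conn K (x, i, b) (x, j, b').
Proof. by move=> n2 n3; apply: (@conn_arcs K 3%N (fun i b => (x, i, b))). Qed.

Lemma conn_face K y : ~~ K 1%N -> ~~ K 2%N ->
  forall i b j b', conn K (y + ebit i, i, b) (y + ebit j, j, b').
Proof.
move=> n1 n2.
apply: (@conn_arcs K 1%N (fun i b => (y + ebit i, i, b))) => // i b.
by rewrite /= addrA addvvK.
Qed.

(** One can move between flags at even vectors that differ by e_k + e_(k+1),
    hence by e_k + e_0 for every k, hence by any even vector. *)
Lemma conn_all K phi psi : ~~ K 1%N -> ~~ K 2%N -> ~~ K 3%N ->
  based phi -> based psi -> conn K phi psi.
Proof.
move=> n1 n2 n3.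
case: phi psi => [[x i] b] [[z j] c]; rewrite /based /= => ex ez.
(* Correcting u by a multiple of e_0 makes it even, and does so additively; the
   displacements by fix0 u can thus be composed for arbitrary u. *)
pose fix0 u := u + (if parity u then ebit 0 else 0).
pose reach u := forall x' i' b' j' b'',
  conn K (x', i', b') (x' + fix0 u, j', b'').
have fix0D u v : fix0 (u + v) = fix0 u + fix0 v.
  rewrite /fix0 parityD addrACA; congr (_ + _).
  by case: (parity u) (parity v) => [] [] /=; rewrite ?addvv ?addr0 ?add0r.
have reach0 : reach 0.
  move=> x' i' b' j' b''; rewrite /fix0 /parity big1 ?addr0 //.
    exact: conn_vertex.
  by move=> k _; rewrite ffunE.
have reachD u v : reach u -> reach v -> reach (u + v).
  move=> ru rv x' i' b' j' b''; rewrite fix0D addrA.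
  exact: connect_trans (ru _ _ _ i' b') (rv _ _ _ _ _).
have reach_edge k : reach (ebit k + ebit (k + 1)).
  move=> x' i' b' j' b''; rewrite fix0D /fix0 !parity_ebit addrACA addvv addr0.
  apply: connect_trans (conn_vertex _ n2 n3 i' b' k false) _.
  apply: connect_trans (conn_move _ (isT : 0 < 1 < 4)%N n1) _.
  exact: conn_vertex.
have reach_nat d : reach (ebit d%:R).
  elim: d => [|d IH].
    move=> x' i' b' j' b''; rewrite /fix0 parity_ebit addvv addr0.
    exact: conn_vertex.
  rewrite -[ebit _](addKvv (ebit d%:R)); apply: (reachD _ _ IH).
  by rewrite -natr1; apply: reach_edge.
have reach_all u : reach u.
  have -> : u = \sum_(k | u k) ebit k.
    apply/ffunP => k; rewrite sum_ffunE; case uk: (u k).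
      rewrite (bigD1 k) //= ffunE eqxx big1 ?addr0 // => l /andP[_ nlk].
      by rewrite ffunE eq_sym (negPf nlk).
    rewrite big1 // => l ul; rewrite ffunE; case: eqP => // def_k.
    by rewrite def_k ul in uk.
  apply: (big_ind reach) => // k _; rewrite -[k]natr_Zp; exact: reach_nat.
have := reach_all (x + z) x i b j c.
rewrite /fix0 parityD; move: ex ez; rewrite !inE => /negPf -> /negPf -> /=.
by rewrite addr0 addKvv.
Qed.

(** Flags that share their edge are listed in [edge_codes], which gives the
    path.  Otherwise the edge may change: one move suffices if the vertex and
    the 2-face are common, and else the path turns around the common vertex, or
    around the common 2-face, or is unconstrained. *)
Lemma strong_conn phi psi : based phi -> based psi ->
  conn [pred r | cell phi r == cell psi r] phi psi.
Proof.
move=> bphi bpsi; set K := [pred r | _].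
have moved r chi : (0 < r < 4)%N -> cell chi r = cell phi r ->
    cell psi r = cell (move r chi) r -> ~~ K r.
  by move=> r_ok eq1 eq2; rewrite inE -eq1 eq2 eq_sym cell_moveN.
case K2: (K 2%N).
  case: (edge_codes (eqP K2)) => def_psi.
  - by rewrite def_psi connect0.
  - rewrite def_psi; apply: conn_move => //.
    by apply: (moved _ phi); rewrite ?def_psi.
  - rewrite def_psi; apply: conn_move => //.
    by apply: (moved _ phi); rewrite ?def_psi.
  - rewrite def_psi; apply: (@connect_trans _ _ (move 1 phi));
      apply: conn_move => //.
      by apply: (moved _ phi); rewrite // def_psi cell_move.
    by apply: (moved _ (move 1 phi)); rewrite ?def_psi // cell_move.
move/negbT: K2 => n2.
case K1: (K 1%N); last first.
  move/negbT: K1 => n1; case K3: (K 3%N); last exact: conn_all (negbT K3) _ _.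
  move: K3 {bphi bpsi moved} n1 n2; rewrite {1}/K inE => /eqP.
  move: (K) => K0; case: phi psi {K} => [[x i] b] [[z j] c] /=.
  move=> /nbrs_inj eq_y n1 n2.
  rewrite -[x](addvvK x (ebit i)) -[z](addvvK z (ebit j)) -eq_y.
  exact: conn_face.
case K3: (K 3%N); last first.
  move/negbT: K3; move: K1 n2 {bphi bpsi moved}; rewrite {1}/K inE => /eqP.
  move: (K) => K0; case: phi psi {K} => [[x i] b] [[z j] c] /=.
  move=> /set1_inj -> n1 n2.
  exact: conn_vertex.
have {K1} eq1 : cell phi 1 = cell psi 1 by apply/eqP.
have {K3} eq3 : cell phi 3 = cell psi 3 by apply/eqP.
suff [-> | ->] : psi = phi \/ psi = move 2 phi; first exact: connect0.
  exact: conn_move.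
move: eq1 eq3; case: (phi) (psi) => [[x i] b] [[z j] c] /= /set1_inj ->.
move=> /nbrs_inj/addrI/ebit_inj ->.
by have [-> | /pm_other ->] := eqVneq c b; [left | right].
Qed.

End Connection.

(** * The halved cube as a polytope *)

Definition is_cell (A : {set vec}) : bool :=
  [exists phi : code, based phi && [exists r : 'I_5, A == cell phi r]].

Definition hface : Type := {A : {set vec} | is_cell A}.

HB.instance Definition _ := Finite.on hface.

Implicit Types F G H : hface.

Definition vset F : {set vec} := val F.

Lemma vset_inj : injective vset.
Proof. exact: val_inj. Qed.

Definition hface_le F G : bool := vset F \subset vset G.

Lemma hface_le_refl : reflexive hface_le.
Proof. by move=> F; apply: subxx. Qed.

Lemma hface_le_anti : antisymmetric hface_le.
Proof.
move=> F G /andP[leFG leGF]; apply/vset_inj/eqP; rewrite eqEsubset.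
exact/andP.
Qed.

Lemma hface_le_trans : transitive hface_le.
Proof. by move=> G F H; apply: subset_trans. Qed.

Fact hface_display : Order.disp_t. Proof. exact: Order.Disp tt tt. Qed.

HB.instance Definition _ := Order.Le_isPOrder.Build hface_display hface
  hface_le_refl hface_le_anti hface_le_trans.

Definition rk F : nat := cardrank (vset F).

Lemma leE F G : (F <= G)%O = (vset F \subset vset G).
Proof. by []. Qed.

Lemma hfaceP F :
  exists2 phi, based phi & vset F = cell phi (rk F) /\ (rk F < 5)%N.
Proof.
have /existsP[phi /andP[b_phi /existsP[r /eqP eq_F]]] := valP F.
by exists phi; rewrite // /rk /vset eq_F cardrank_cell.
Qed.

Lemma rk_lt5 F : (rk F < 5)%N.
Proof. by have [phi _ []] := hfaceP F. Qed.

Lemma is_cellP phi r : based phi -> (r < 5)%N -> is_cell (cell phi r).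
Proof.
move=> b_phi lt_r5; apply/existsP; exists phi; rewrite b_phi.
by apply/existsP; exists (Ordinal lt_r5) => /=.
Qed.

Definition mkface phi r (b_phi : based phi) (lt_r5 : (r < 5)%N) : hface :=
  exist _ (cell phi r) (is_cellP b_phi lt_r5).

Lemma rk_mkface phi r b_phi lt_r5 : rk (@mkface phi r b_phi lt_r5) = r.
Proof. exact: cardrank_cell. Qed.

Lemma rk_strict F G : (F < G)%O -> (rk F < rk G)%N.
Proof.
rewrite lt_neqAle leE => /andP[neqFG le_FG]; rewrite ltnNge.
apply: contra neqFG => le_r; apply/eqP/vset_inj/eqP; rewrite eqEcard le_FG.
have [phi _ [-> lt_r]] := hfaceP F; have [psi b_psi [-> _]] := hfaceP G.
rewrite (leq_trans (subset_leq_card (cell_mono b_psi le_r))) //.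
by rewrite !card_cell.
Qed.

(** Phrasing membership with the rank of F makes comparing two flags a matter of
    comparing their cells index by index. *)
Definition flagset phi : {set hface} := [set F | vset F == cell phi (rk F)].

Lemma flagset_is_flag phi : based phi -> is_flag (flagset phi).
Proof.
move=> b_phi; apply: (full_chain_flag rk_strict).
  apply/chainP => F G; rewrite !inE /Order.comparable !leE => /eqP-> /eqP->.
  by case/orP: (leq_total (rk F) (rk G)) => /(cell_mono b_phi) ->;
    rewrite ?orbT.
move=> G; have lt_r := rk_lt5 G.
by exists (mkface b_phi lt_r); rewrite ?inE rk_mkface.
Qed.

Lemma zero_based : based (0, 0, false).
Proof. by rewrite /based inE /parity big1 // => k _; rewrite ffunE. Qed.

Definition hmin := mkface zero_based (isT : 0 < 5)%N.
Definition hmax := mkface zero_based (isT : 4 < 5)%N.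

Lemma hmin_le F : (hmin <= F)%O. Proof. exact: sub0set. Qed.

Lemma le_hmax F : (F <= hmax)%O.
Proof.
have [phi b_phi [eqF lt_r]] := hfaceP F; rewrite leE eqF.
have -> : vset hmax = cell phi 4 by case: (phi) => [[]].
exact: cell_mono.
Qed.

Lemma vset_common F G : (F <= G)%O ->
  exists2 chi, based chi & vset F = cell chi (rk F) /\ vset G = cell chi (rk G).
Proof.
have [phi b_phi [eqF lt_F]] := hfaceP F.
have [psi b_psi [eqG lt_G]] := hfaceP G.
move=> leFG; have le_r : (rk F <= rk G < 5)%N.
  rewrite lt_G andbT.
  by move: leFG; rewrite le_eqVlt => /predU1P[-> // | /rk_strict/ltnW].
move: leFG; rewrite leE eqF eqG => /(common_code le_r b_phi b_psi).
by case=> chi [b_chi <- <-]; exists chi.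
Qed.

Lemma fill F G :
  (F < G)%O -> exists H, [/\ F < H, H <= G & rk H = (rk F).+1]%O.
Proof.
move=> ltFG; have lt_r := rk_strict ltFG.
have [chi b_chi [eqF eqG]] := vset_common (ltW ltFG).
have lt_G := rk_lt5 G.
have lt_H := leq_ltn_trans lt_r lt_G.
exists (mkface b_chi lt_H); rewrite rk_mkface; split=> //.
  rewrite lt_neqAle; apply/andP; split.
    by apply: contra_eqN (rk_mkface b_chi lt_H) => /eqP <-; rewrite ltn_eqF.
  by rewrite leE eqF cell_mono.
by rewrite leE eqG cell_mono.
Qed.

(** A maximal chain has a face of each rank by [flag_next]; its edge and 2-face
    have a common code, which is adjusted by move 1 to have the right vertex. *)
Lemma flag_code A : is_flag A -> exists2 phi, based phi & A = flagset phi.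
Proof.
move=> flagA; have cA : chain A by case/maxsetP: flagA.
have next F : F \in A -> (rk F < 4)%N -> exists2 H, H \in A & rk H = (rk F).+1.
  move=> FA lt_F; apply: (flag_next rk_strict flagA FA le_hmax (@fill F)).
  by rewrite rk_mkface.
have F0A : hmin \in A.
  by apply: (flag_comparable flagA) => G _; rewrite /Order.comparable hmin_le.
have [|F1 F1A] := next _ F0A; rewrite rk_mkface // => rk1.
have [|F2 F2A] := next _ F1A; rewrite rk1 // => rk2.
have [|F3 F3A] := next _ F2A; rewrite rk2 // => rk3.
have le12 : (F1 <= F2)%O.
  by rewrite (chain_rank_le rk_strict cA) // rk1 rk2.
have le23 : (F2 <= F3)%O.
  by rewrite (chain_rank_le rk_strict cA) // rk2 rk3.
have [chi b_chi []] := vset_common le23; rewrite rk2 rk3 => eq2 eq3.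
have [phi b_phi [eq1 _]] := hfaceP F1; rewrite rk1 in eq1.
have [om] : exists2 om, om = chi \/ om = move 1 chi & cell om 1 = cell phi 1.
  move: le12; rewrite leE eq1 eq2; case: (phi) => [[x i] b].
  rewrite sub1set => /vertex_of_edge[om def_om <-].
  by exists om => //; case: (om) => [[]].
move=> def_om eq_om; have b_om : based om.
  by case: def_om => ->; rewrite ?based_move.
have {eq2}eq2 : vset F2 = cell om 2 by case: def_om => ->; rewrite ?cell_move.
have {eq3}eq3 : vset F3 = cell om 3 by case: def_om => ->; rewrite ?cell_move.
exists om => //; case/maxsetP: flagA => _ maxA; apply/esym/maxA.
  by case/maxsetP: (flagset_is_flag b_om).
apply/subsetP => K KA; rewrite inE; apply/eqP.
have same F : F \in A -> rk K = rk F -> K = F.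
  by apply: (chain_rank_inj rk_strict cA).
have [psi b_psi [eqK lt_K]] := hfaceP K; rewrite eqK.
move: lt_K (same _ F1A) (same _ F2A) (same _ F3A); rewrite -eqK rk1 rk2 rk3.
case: (rk K) eqK => [|[|[|[|[|r]]]]] //= eqK _ s1 s2 s3.
- by rewrite eqK; case: (psi) (om) => [[? ?] ?] [[? ?] ?].
- by rewrite s1 // eq1.
- by rewrite s2.
- by rewrite s3.
- by rewrite eqK; case: (psi) (om) => [[? ?] ?] [[? ?] ?].
Qed.

Definition face_in phi (b_phi : based phi) (r : 'I_5) : hface :=
  mkface b_phi (ltn_ord r).

Lemma card_flagset_where phi (P : pred nat) : based phi ->
  #|[set F in flagset phi | P (rk F)]| = #|[set r : 'I_5 | P r]|.
Proof.
move=> b_phi; rewrite -(@card_imset _ _ (face_in b_phi)); last first.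
  move=> r s /(congr1 rk); rewrite !rk_mkface; exact: val_inj.
apply: eq_card => F; rewrite !inE; apply/andP/imsetP => [[/eqP eqF PF] | [r]].
  have lt_F := rk_lt5 F; exists (Ordinal lt_F); rewrite ?inE //.
  by apply: vset_inj.
by rewrite inE => Pr ->; rewrite rk_mkface.
Qed.

Lemma card_flagset phi : based phi -> #|flagset phi| = 5.
Proof.
move=> b_phi; transitivity #|[set F in flagset phi | predT (rk F)]|.
  by apply: eq_card => F; rewrite !inE andbT.
rewrite card_flagset_where // -[RHS](card_ord 5) -cardsT.
by apply: eq_card => r; rewrite !inE.
Qed.

Lemma flagset_inj phi psi : based phi -> based psi ->
  flagset phi = flagset psi -> phi = psi.
Proof.
move=> b_phi b_psi eq_f; apply: code_inj => r /andP[_ lt_r4].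
have lt_r5 : (r < 5)%N by apply: ltnW.
have : mkface b_phi lt_r5 \in flagset psi by rewrite -eq_f inE rk_mkface.
by rewrite inE rk_mkface => /eqP.
Qed.

Lemma differ_move phi r : based phi -> (0 < r < 4)%N ->
  differ_in_one (flagset phi) (flagset (move r phi)).
Proof.
move=> b_phi r_ok; rewrite /differ_in_one.
have gen psi chi : based psi ->
    (forall s, (s < 5)%N -> (cell psi s != cell chi s) = (s == r)) ->
    #|flagset psi :\: flagset chi| = 1%N.
  move=> b_psi eq_s; have lt_r5 : (r < 5)%N by case/andP: r_ok => _ /ltnW.
  rewrite -(card1 (Ordinal lt_r5)).
  transitivity #|[set F in flagset psi | rk F == r]|.
    apply: eq_card => F; rewrite !inE andbC; case: eqP => //= eqF.
    by rewrite eqF eq_s ?rk_lt5.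
  rewrite (card_flagset_where (pred1 r)) //.
  by apply: eq_card => s; rewrite !inE.
have cells s : (cell phi s != cell (move r phi) s) = (s == r).
  case: (eqVneq s r) => [-> | nsr]; first by rewrite eq_sym cell_moveN.
  by rewrite cell_move ?eqxx.
rewrite !gen ?based_move // => s _.
by rewrite eq_sym cells.
Qed.

Lemma move_sub phi psi chi r : (0 < r < 4)%N -> cell phi r != cell psi r ->
  flagset phi :&: flagset psi \subset flagset chi ->
  flagset phi :&: flagset psi \subset flagset (move r chi).
Proof.
move=> r_ok neq /subsetP sub; apply/subsetP => F FS; have := sub F FS.
rewrite !inE cell_move //; apply: contraNneq neq => eq_r; move: FS.
by rewrite !inE eq_r => /andP[/eqP <- /eqP <-].
Qed.

Lemma hface_strongly_connected A B : is_flag A -> is_flag B ->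
  exists s : seq {set hface},
    [/\ path (@differ_in_one _ hface) A s, last A s = B &
        all (fun C => is_flag C && (A :&: B \subset C)) s].
Proof.
move=> /flag_code[phi b_phi ->] /flag_code[psi b_psi ->].
have /connectP[p] := strong_conn b_phi b_psi.
set K := [pred r | _].
have sub0 : flagset phi :&: flagset psi \subset flagset phi.
  exact: subsetIl.
have : forall chi, based chi ->
    flagset phi :&: flagset psi \subset flagset chi ->
    path (step K) chi p -> psi = last chi p ->
    exists s, [/\ path (@differ_in_one _ hface) (flagset chi) s,
      last (flagset chi) s = flagset psi &
      all (fun C => is_flag C && (flagset phi :&: flagset psi \subset C)) s].
  elim: p => [|om p IH] chi b_chi sub_chi /=; first by move=> _ ->; exists [::].
  case/andP=> /existsP[r /and3P[r_gt0 nKr /eqP def_om]] path_p last_p.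
  have r_ok : (0 < r < 4)%N by rewrite r_gt0 ltn_ord.
  have b_om : based om by rewrite def_om based_move.
  have sub_om : flagset phi :&: flagset psi \subset flagset om.
    by rewrite def_om; apply: move_sub.
  have [s [path_s last_s all_s]] := IH om b_om sub_om path_p last_p.
  exists (flagset om :: s); split=> //=.
    by rewrite path_s def_om differ_move.
  by rewrite all_s sub_om flagset_is_flag.
by move=> gen path_p last_p; apply: gen.
Qed.

Lemma hface_diamond F G : (F < G)%O -> rk G = (rk F).+2 ->
  #|[set H : hface | (F < H < G)%O]| = 2%N.
Proof.
move=> ltFG eq_r; have [chi b_chi [eqF eqG]] := vset_common (ltW ltFG).
have [_ _ [_ lt_G]] := hfaceP G; rewrite eq_r in lt_G eqG.
have lt_r5 : ((rk F).+1 < 5)%N by apply: ltnW.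
have r_ok : (0 < (rk F).+1 < 4)%N by rewrite -ltnS.
set r := (rk F).+1 in lt_r5 r_ok.
have b_mv : based (move r chi) by rewrite based_move.
have rkH H : (F < H < G)%O -> rk H = r.
  case/andP=> /rk_strict lt1 /rk_strict; rewrite eq_r ltnS => le2.
  by apply/eqP; rewrite eqn_leq lt1 le2.
have strict H : vset F \subset vset H -> vset H \subset vset G -> rk H = r ->
    (F < H < G)%O.
  move=> sFH sHG eq_H; rewrite !lt_neqAle !leE sFH sHG !andbT.
  apply/andP; split.
    by apply: contra_eqN eq_H => /eqP <-; rewrite ltn_eqF.
  by apply: contra_eqN eq_H => /eqP ->; rewrite eq_r gtn_eqF.
have -> : [set H : hface | (F < H < G)%O] =
    [set mkface b_chi lt_r5; mkface b_mv lt_r5].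
  apply/setP => H; rewrite !inE; apply/idP/orP => [FHG | ].
    have eq_H := rkH H FHG; case/andP: FHG => /ltW + /ltW.
    have [psi b_psi [eqH _]] := hfaceP H.
    rewrite !leE eqF eqG eqH eq_H => s1 s2.
    case: (between_codes r_ok s1 s2) => eq_c; [left | right];
      by apply/eqP/vset_inj; rewrite eqH eq_H.
  have neqs s : s != r -> cell chi s = cell (move r chi) s.
    by move=> ?; rewrite cell_move.
  case=> /eqP ->; apply: strict; rewrite ?rk_mkface // ?eqF ?eqG ?cell_mono //.
    by rewrite neqs ?cell_mono // ltn_eqF.
  by rewrite neqs ?cell_mono // gtn_eqF.
rewrite cards2; case: eqP => // /(congr1 vset)/eqP.
by rewrite eq_sym (negPf (cell_moveN _ r_ok)).
Qed.

Definition hrank F : int := (rk F)%:Z - 1.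

Lemma halved_cube_polytopeP : is_polytope 3 hrank hmin hmax.
Proof.
split.
- move=> F; have lt_F := rk_lt5 F; rewrite /hrank; split.
    by rewrite lerBrDr addNr.
  by rewrite lerBlDr.
- by move=> F G /rk_strict lt_r; rewrite /hrank ltrD2r ltz_nat.
- by rewrite /hrank rk_mkface.
- by rewrite /hrank rk_mkface.
- move=> F; split=> [minF | -> G]; last by rewrite le_gtF ?hmin_le.
  by apply/eqP; have := minF hmin; rewrite lt_neqAle hmin_le andbT negbK eq_sym.
- move=> F; split=> [maxF | -> G]; last by rewrite le_gtF ?le_hmax.
  by apply/eqP; have := maxF hmax; rewrite lt_neqAle le_hmax andbT negbK.
- move=> A /flag_code[phi b_phi ->]; rewrite card_flagset // !inE !rk_mkface.
  by split=> //; apply/eqP; case: (phi) => [[]].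
- move=> F G ltFG eq_r; apply: hface_diamond => //; move: eq_r.
  rewrite /hrank opprB addrA addrNK => /eqP.
  by rewrite subr_eq -PoszD => /eqP[->]; rewrite addnC addn2.
- exact: hface_strongly_connected.
Qed.

Definition halved_cube : polytope 3 := Polytope halved_cube_polytopeP.

Lemma card_flags : #|flags halved_cube| = (2 ^ n.+3 * n.+3)%N.
Proof.
have -> : flags halved_cube = flagset @: [set phi | based phi].
  apply/setP => A; rewrite inE.
  apply/idP/imsetP => [/flag_code[phi b_phi ->] | [phi]].
    by exists phi; rewrite ?inE.
  by rewrite inE => b_phi ->; apply: flagset_is_flag.
rewrite card_in_imset; last by move=> phi psi; rewrite !inE; apply: flagset_inj.
have -> : [set phi | based phi] = setX (setX evens [set: idx]) [set: bool].
  by apply/setP => [[[x i] b]]; rewrite !inE /= !andbT /based inE.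
rewrite !cardsX card_evens !cardsT card_ord card_bool.
by rewrite mulnAC [in RHS]expnSr.
Qed.

(** * Symmetries *)

Definition sgz b k : idx := if b then - k else k.

Lemma sgzK b : involutive (sgz b).
Proof. by case: b => k //=; rewrite opprK. Qed.

Lemma sgzD b k i : sgz b (k + i) = sgz b k + sgz b i.
Proof. by case: b; rewrite //= opprD. Qed.

Lemma sgz_pm b b' : sgz b (pm b') = pm (b' (+) b).
Proof. by case: b b' => [] []; rewrite /= ?opprK. Qed.

(** The coordinate permutation induced by the dihedral map k |-> a + sgz b k,
    which [lin_ebit] shows on unit vectors; the formula evaluates u at the
    preimage of k. *)
Definition lin (a : idx) b u : vec := [ffun k => u (sgz b (k - a))].

Lemma linD a b u v : lin a b (u + v) = lin a b u + lin a b v.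
Proof. by apply/ffunP => k; rewrite !ffunE. Qed.

Lemma lin_ebit a b i : lin a b (ebit i) = ebit (a + sgz b i).
Proof.
apply/ffunP => k; rewrite !ffunE -(inj_eq (can_inj (sgzK b))) sgzK.
by rewrite subr_eq addrC.
Qed.

Lemma lin_comp a a' u : lin a' true (lin a true u) = lin (a' - a) false u.
Proof.
by apply/ffunP => k; rewrite !ffunE /= opprD !opprK opprB addrA addrAC.
Qed.

Lemma lin_shift a a' u : lin a' false (lin a false u) = lin (a + a') false u.
Proof. by apply/ffunP => k; rewrite !ffunE /= opprD addrA addrAC. Qed.

Lemma lin0 u : lin 0 false u = u.
Proof. by apply/ffunP => k; rewrite !ffunE /= subr0. Qed.

Lemma parity_lin a b u : parity (lin a b u) = parity u.
Proof.
have dih_inj : injective (fun k => a + sgz b k).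
  by move=> i j /addrI; apply: (can_inj (sgzK b)).
rewrite /parity (reindex_inj dih_inj) /=.
by apply: eq_bigr => k _; rewrite ffunE addrC addKr sgzK.
Qed.

Lemma lin_inj a b : injective (lin a b).
Proof.
move=> u v /ffunP eq_uv; apply/ffunP => k.
by have := eq_uv (a + sgz b k); rewrite !ffunE addrC addKr sgzK.
Qed.

Definition aff v (a : idx) b u := v + lin a b u.

Lemma aff_inj v a b : injective (aff v a b).
Proof. by move=> u w /addrI/lin_inj. Qed.

Definition aff_code v (a : idx) b phi : code :=
  let: (x, i, d) := phi in (aff v a b x, a + sgz b i, d (+) b).

Lemma affD v a b x u : aff v a b (x + u) = aff v a b x + lin a b u.
Proof. by rewrite /aff linD addrA. Qed.

Lemma aff_even v a b x : v \in evens -> (aff v a b x \in evens) = (x \in evens).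
Proof. by rewrite !inE parityD parity_lin => /negPf->. Qed.

Lemma aff_based v a b phi :
  v \in evens -> based (aff_code v a b phi) = based phi.
Proof. by case: phi => [[x i] d] ev; rewrite /based /= aff_even. Qed.

Lemma aff_cell v a b phi r : v \in evens -> (r < 5)%N ->
  aff v a b @: cell phi r = cell (aff_code v a b phi) r.
Proof.
move=> ev lt_r5; apply/eqP; rewrite eqEcard card_imset; last exact: aff_inj.
rewrite !card_cell // leqnn andbT.
case: phi => [[x i] d]; case: r lt_r5 => [|[|[|[|[|r]]]]] //= _.
- by rewrite imset0.
- by rewrite imset_set1.
- rewrite imsetU !imset_set1 affD linD !lin_ebit sgzD sgz_pm.
  by rewrite [a + (_ + _)]addrA.
- apply/subsetP => _ /imsetP[_ /nbrsP[k ->] ->].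
  by apply/nbrsP; exists (a + sgz b k); rewrite !affD !lin_ebit.
- by apply/subsetP => _ /imsetP[z ez ->]; rewrite aff_even.
Qed.

Lemma aff_is_cell v a b F : v \in evens -> is_cell (aff v a b @: vset F).
Proof.
move=> ev; have [phi b_phi [-> lt_F]] := hfaceP F.
by rewrite aff_cell // is_cellP ?aff_based.
Qed.

Lemma aff_aut v a b : v \in evens ->
  exists2 s : {perm halved_cube}, s \in automorphisms halved_cube &
    forall F, vset (s F) = aff v a b @: vset F.
Proof.
move=> ev; pose g F : hface :=
  exist _ (aff v a b @: vset F) (aff_is_cell a b F ev).
have vset_g F : vset (g F) = aff v a b @: vset F by [].
have le_g F G : (g F <= g G)%O = (F <= G)%O.
  rewrite !leE !vset_g; apply/idP/idP; last exact: imsetS.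
  move/subsetP => sub; apply/subsetP => z zF.
  have /imsetP[w wG /aff_inj -> //] := sub _ (imset_f (aff v a b) zF).
have inj_g : injective g.
  by move=> F G eq_g; apply: le_anti; rewrite -(le_g F G) -(le_g G F) eq_g lexx.
exists (perm inj_g); last by move=> F; rewrite permE.
rewrite inE; apply/andP; split; apply/forallP => F.
  by apply/forallP => G; rewrite !permE le_g.
by rewrite permE /= /hrank /rk /cardrank vset_g card_imset //; apply: aff_inj.
Qed.

Lemma aff_flagset v a b (s : {perm halved_cube}) phi :
    v \in evens -> based phi ->
    (forall F, vset (s F) = aff v a b @: vset F) ->
  'P^*%act (flagset phi) s = flagset (aff_code v a b phi).
Proof.
move=> ev b_phi s_aff; apply/eqP; rewrite eqEcard /= /setact.
rewrite card_imset; last by move=> F G; apply: perm_inj.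
rewrite !card_flagset ?aff_based // andbT.
apply/subsetP => _ /imsetP[F FA ->]; move: FA; rewrite !inE /= apermE.
rewrite {2}/rk s_aff => /eqP ->; rewrite aff_cell ?rk_lt5 //.
by rewrite cardrank_cell ?rk_lt5.
Qed.

(** The dihedral map is the one that carries the arc of phi to that of psi, and
    the translation part is then determined by the two vectors. *)
Lemma transport phi psi : based phi -> based psi ->
  exists v a b, v \in evens /\ aff_code v a b phi = psi.
Proof.
case: phi psi => [[x i] b] [[z j] d]; rewrite /based /= => ex ez.
exists (z + lin (j - sgz (d (+) b) i) (d (+) b) x).
exists (j - sgz (d (+) b) i), (d (+) b); split.
  by move: ex ez; rewrite !inE parityD parity_lin => /negPf-> /negPf->.
by rewrite /aff_code /aff addvvK subrK addbC addbK.
Qed.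

Lemma aut_flag (s : {perm halved_cube}) phi :
  s \in automorphisms halved_cube -> based phi ->
  is_flag ('P^*%act (flagset phi) s).
Proof.
rewrite inE => /andP[/forallP s_le /forallP s_rank] b_phi.
have rk_s F : rk (s F) = rk F.
  by have /eqP/addIr[] := s_rank F.
apply: (full_chain_flag rk_strict) => [|G].
  have /maxsetP[/chainP c_phi _] := flagset_is_flag b_phi.
  apply/chainP => _ _ /imsetP[F FA ->] /imsetP[G GA ->].
  have /forallP s_leF := s_le F; have /forallP s_leG := s_le G.
  rewrite /= !apermE /Order.comparable (eqP (s_leF G)) (eqP (s_leG F)).
  exact: c_phi.
exists (s (mkface b_phi (rk_lt5 G))); last by rewrite rk_s rk_mkface.
apply/imsetP; exists (mkface b_phi (rk_lt5 G)) => //.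
by rewrite inE rk_mkface.
Qed.

Lemma halved_cube_regular : regular halved_cube.
Proof.
have flag0 := flagset_is_flag zero_based.
apply/imsetP; exists (flagset (0, 0, false)); first by rewrite inE.
apply/setP => A; rewrite inE.
apply/idP/orbitP => [/flag_code[psi b_psi ->] | [s]].
  have [v [a [b [ev <-]]]] := transport zero_based b_psi.
  have [s aut_s s_aff] := aff_aut a b ev.
  by exists s; last exact: aff_flagset ev zero_based s_aff.
by move=> aut_s <-; apply: aut_flag zero_based.
Qed.

(** * Rotations, reflections and the type *)

(** The cyclic shift of the coordinates by d, about the fixed point p. *)
Definition rot p (d : idx) z : vec := p + lin d false (z + p).

Lemma rot_comp p d d' z : rot p d' (rot p d z) = rot p (d + d') z.
Proof. by rewrite /rot [p + _ + p]addrAC addvv add0r lin_shift. Qed.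

Lemma pmMn b (k : nat) : (pm b *+ k == 0) = (n.+3 %| k)%N.
Proof.
have -> : (pm b *+ k == 0) = (k%:R == 0 :> idx).
  by case: b; rewrite /= ?mulNrn ?oppr_eq0.
by rewrite Zp_nat -val_eqE.
Qed.

(** The k-th power of s is the shift by d = k or d = - k about p.  If it is
    trivial on the polytope, it fixes every even vector, although p itself may
    be odd; taking differences, the linear shift by d fixes every even vector,
    in particular e_0 + e_1, and this forces d = 0 as m > 2. *)
Lemma order_rot p b (s : {perm halved_cube}) :
  (forall F, vset (s F) = rot p (pm b) @: vset F) -> #[s]%g = n.+3.
Proof.
move=> s_rot.
have s_rotX (k : nat) F : vset ((s ^+ k)%g F) = rot p (pm b *+ k) @: vset F.
  elim: k F => [|k IH] F.
    rewrite expg0 perm1 -[LHS]imset_id; apply: eq_imset => z.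
    by rewrite /rot lin0 addrC addvvK.
  rewrite expgSr permM s_rot IH -imset_comp; apply: eq_imset => z /=.
  by rewrite rot_comp mulrSr.
have fixP (k : nat) : (s ^+ k == 1)%g = (n.+3 %| k)%N.
  rewrite -(pmMn b); set d := pm b *+ k; apply/eqP/eqP => [sk1 | d0].
    have fix_even z : z \in evens -> rot p d z = z.
      move=> ez; have := s_rotX k (@mkface (z, 0, false) 1 ez isT).
      by rewrite sk1 perm1 /= imset_set1 => /set1_inj.
    have fix_p : p + lin d false p = 0.
      by have := fix_even 0 zero_based; rewrite /rot add0r.
    have lin_even z : z \in evens -> lin d false z = z.
      by move=> ez; rewrite -[RHS]fix_even // /rot linD addrCA fix_p addr0.
    have := lin_even (ebit 0 + ebit 1).
    rewrite -[_ + _]add0r evensD2 add0r linD !lin_ebit /= addr0.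
    move=> /(_ zero_based) /esym /(@ebit2 0 1 d (d + 1) isT) [[] // | [d1 d2]].
    by move: d2; rewrite d1.
  apply/permP => F; rewrite perm1; apply: vset_inj; rewrite s_rotX -/d d0.
  rewrite -[RHS]imset_id; apply: eq_imset => z.
  by rewrite /rot lin0 addrC addvvK.
by apply/eqP; rewrite eqn_dvd order_dvdn fixP dvdnn -fixP expg_order eqxx.
Qed.

(** The reflection k |-> a - k of the coordinates, about the fixed point p. *)
Definition refl p (a : idx) z : vec := p + lin a true (z + p).

Lemma refl_comp p a a' z : refl p a' (refl p a z) = rot p (a' - a) z.
Proof. by rewrite /refl [p + _ + p]addrAC addvv add0r lin_comp. Qed.

Lemma refl_aff p a z : refl p a z = aff (p + lin a true p) a true z.
Proof. by rewrite /aff /refl linD addrA addrAC. Qed.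

Lemma refl_even p a : p + lin a true p \in evens.
Proof. by rewrite inE parityD parity_lin addbb. Qed.

(** The reflection with a = i + i fixes the coordinate i, hence it fixes
    p + e_i as well as p. *)
Lemma refl_ebit p i : refl (p + ebit i) (i + i) =1 refl p (i + i).
Proof.
move=> z; rewrite /refl addrA [lin _ _ (_ + ebit i)]linD lin_ebit /= addrK.
by rewrite -!addrA; congr (_ + _); rewrite addrC addvvK.
Qed.

Lemma refl_aut p a :
  exists2 s : {perm halved_cube}, s \in automorphisms halved_cube &
    forall F, vset (s F) = refl p a @: vset F.
Proof.
have [s aut_s s_aff] := aff_aut a true (refl_even p a).
by exists s => // F; rewrite s_aff; apply: eq_imset => z; rewrite refl_aff.
Qed.

Lemma refl_generator p a r (s : {perm halved_cube}) phi :
    s \in automorphisms halved_cube ->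
    (forall F, vset (s F) = refl p a @: vset F) ->
    (r < 3)%N -> based phi ->
    aff_code (p + lin a true p) a true phi = move r.+1 phi ->
  [/\ s \in automorphisms halved_cube,
      'P^*%act (flagset phi) s \in flags halved_cube
    & @differ_exactly_at 3 halved_cube r (flagset phi)
        ('P^*%act (flagset phi) s)].
Proof.
move=> aut_s s_refl lt_r3 b_phi code_s.
have -> : 'P^*%act (flagset phi) s = flagset (move r.+1 phi).
  rewrite -code_s; apply: aff_flagset (refl_even p a) b_phi _ => F.
  by rewrite s_refl; apply: eq_imset => z; rewrite refl_aff.
have b_mv : based (move r.+1 phi) by rewrite based_move.
split=> //; first by rewrite inE flagset_is_flag.
have r_ok : (0 < r.+1 < 4)%N by [].
apply/andP; split.
  apply: contraNneq (cell_moveN phi r_ok) => eq_f.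
  by rewrite -(flagset_inj b_phi b_mv eq_f).
apply/forallP => F; apply/implyP; rewrite !inE.
case: (eqVneq (rk F) r.+1) => [rkF _ | neq]; last by rewrite cell_move ?eqxx.
by rewrite /= /hrank rkF -addn1 PoszD addrK.
Qed.

Lemma halved_cube_type : has_schlafli_type halved_cube [:: n.+3; n.+3].
Proof.
move=> A; rewrite inE => /flag_code[phi b_phi ->].
case: phi b_phi => [[x i] b] b_phi.
pose j := i + pm b; pose y := x + ebit i.
have [s0 aut0 refl0] := refl_aut y (i + j).
have [s1 aut1 refl1] := refl_aut x (i + i).
have [s2 aut2 refl2] := refl_aut x (i + j).
have code0 : aff_code (y + lin (i + j) true y) (i + j) true (x, i, b) =
    move 1 (x, i, b).
  have lin_y : lin (i + j) true y = ebit j + lin (i + j) true x.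
    by rewrite linD lin_ebit /= [i + j]addrC addrK [ebit j + _]addrC.
  by rewrite /= addbT {3}[i + j]addrC addrK /aff lin_y !addrA addvvK.
have code1 : aff_code (x + lin (i + i) true x) (i + i) true (x, i, b) =
    move 2 (x, i, b).
  by rewrite /= addbT addrK /aff addvvK.
have code2 : aff_code (x + lin (i + j) true x) (i + j) true (x, i, b) =
    move 3 (x, i, b).
  by rewrite /= addbT [i + j]addrC addrK /aff addvvK.
have d12 : i + j - (i + i) = pm b.
  by rewrite opprD addrA [i + j]addrC addrK /j [i + _]addrC addrK.
exists (nth 1%g [:: s0; s1; s2]).
  case=> [|[|[|//]]] _ /=.
  - exact: refl_generator aut0 refl0 _ b_phi code0.
  - exact: refl_generator aut1 refl1 _ b_phi code1.
  - exact: refl_generator aut2 refl2 _ b_phi code2.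
rewrite /= (@order_rot y (~~ b)) ?(@order_rot x b) // => F.
  rewrite permM refl2 refl1 -imset_comp; apply: eq_imset => z /=.
  by rewrite refl_comp d12.
rewrite permM refl1 refl0 -imset_comp; apply: eq_imset => z /=.
(* s1, the reflection about x with a = i + i, is also one about y = x + e_i, so
   s0 and s1 share a fixed point. *)
by rewrite -refl_ebit refl_comp -opprB d12 pmN.
Qed.

(** * Self-duality *)

(** Common cube neighbours of A, translated by e_0: a vector z + e_0 with z even
    is an arbitrary odd vector. *)
Definition polar (A : {set vec}) : {set vec} :=
  [set z in evens | A \subset nbrs (z + ebit 0)].

(** The 2-face of (x, i, b) is centred at x + e_i, which translated by e_0
    becomes the vertex of the dual flag; the arc is kept. *)
Definition polar_code phi : code :=
  let: (x, i, b) := phi in (x + (ebit i + ebit 0), i, b).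

Lemma polar_codeK : involutive polar_code.
Proof. by case=> [[x i] b]; rewrite /= addvvK. Qed.

Lemma polar_based phi : based (polar_code phi) = based phi.
Proof. by case: phi => [[x i] b]; rewrite /based /= evensD2. Qed.

Lemma nbrs_shift x u z : (x + u \in nbrs (z + u)) = (x \in nbrs z).
Proof.
apply/nbrsP/nbrsP => -[k eq_k]; exists k; last by rewrite eq_k addrAC.
by rewrite -[x](addvvK x u) eq_k addrAC addvvK.
Qed.

(** On edges this is the fact that the two common neighbours of the ends of a
    diagonal are the ends of the other diagonal; on 2-faces it is the
    injectivity of [nbrs]. *)
Lemma polar_cell phi r : based phi -> (r < 5)%N ->
  polar (cell phi r) = cell (polar_code phi) (4 - r).
Proof.
case: phi => [[x i] b]; set phi := (x, i, b) => b_phi; set j := i + pm b.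
have ex : x \in evens by [].
case: r => [|[|[|[|[|r]]]]] // _; apply/setP => z; rewrite [LHS]in_set /=.
- by rewrite sub0set andbT.
- have -> : x + (ebit i + ebit 0) + ebit i = x + ebit 0.
    by rewrite [ebit i + _]addrC addrA addvvK.
  rewrite sub1set nbrs_sym -(nbrs_shift z (ebit 0)) addvvK.
  apply: andb_idl => /nbrsP[k eq_z].
  by rewrite -[z](addvvK z (ebit 0)) eq_z -addrA evensD2.
- have -> : x + (ebit i + ebit 0) + (ebit i + ebit j) = x + (ebit j + ebit 0).
    by rewrite -addrA addrACA addvv add0r [ebit 0 + _]addrC.
  have face_z k : z = x + (ebit k + ebit 0) -> z + ebit 0 = x + ebit k.
    by move=> ->; rewrite addrA addvvK.
  apply/andP/set2P => [[_ sub] | def_z].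
    have eq_z k : nbrs (z + ebit 0) = nbrs (x + ebit k) ->
        z = x + (ebit k + ebit 0).
      by move=> /nbrs_inj eq_k; rewrite addrA -eq_k addvvK.
    have [chi [-> | ->] eq_n] := @face_of_edge phi _ sub.
      by left; apply: eq_z.
    by right; apply: eq_z.
  case: def_z => def_z; rewrite (face_z _ def_z) def_z evensD2; split=> //.
    exact: (@cell_mono phi 2 3).
  have : cell (move 3 phi) 2 \subset cell (move 3 phi) 3.
    by rewrite cell_mono ?based_move.
  by rewrite cell_move.
- rewrite in_set1; apply/andP/eqP => [[_ sub] | ->].
    have /nbrs_inj eq_z : nbrs (x + ebit i) = nbrs (z + ebit 0).
      by apply/eqP; rewrite eqEcard sub !card_nbrs leqnn.
    by rewrite addrA eq_z addvvK.
  by rewrite evensD2 addrA addvvK.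
- rewrite in_set0; apply/negbTE/negP => /andP[_ /subset_leq_card].
  by rewrite card_evens card_nbrs leqNgt lt_expn2.
Qed.

Lemma polar_is_cell F : is_cell (polar (vset F)).
Proof.
have [phi b_phi [-> lt_F]] := hfaceP F.
by rewrite polar_cell // is_cellP ?polar_based // ltnS leq_subr.
Qed.

Definition polar_face F : hface := exist _ (polar (vset F)) (polar_is_cell F).

Lemma vset_polar F : vset (polar_face F) = polar (vset F).
Proof. by []. Qed.

Lemma rk_polar F : rk (polar_face F) = (4 - rk F)%N.
Proof.
have [phi b_phi [eqF lt_F]] := hfaceP F.
by rewrite {1}/rk vset_polar eqF polar_cell // cardrank_cell // ltnS leq_subr.
Qed.

Lemma polar_faceK : involutive polar_face.
Proof.
move=> F; have [phi b_phi [eqF lt_F]] := hfaceP F; apply: vset_inj.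
rewrite !vset_polar eqF polar_cell // polar_cell ?polar_based ?polar_codeK //.
  by rewrite subKn.
by rewrite ltnS leq_subr.
Qed.

Lemma polar_face_le F G : (polar_face G <= polar_face F)%O = (F <= G)%O.
Proof.
have anti H K : (H <= K)%O -> (polar_face K <= polar_face H)%O.
  move=> leHK; apply/subsetP => z; rewrite !inE => /andP[-> /=].
  exact: subset_trans.
by apply/idP/idP => /anti //; rewrite !polar_faceK.
Qed.

Lemma halved_cube_self_dual : self_dual halved_cube.
Proof.
exists polar_face; first exact: inv_bij polar_faceK.
apply/andP; split; apply/forallP => F.
  by apply/forallP => G; rewrite -(polar_face_le F G).
have lt_F := rk_lt5 F; apply/eqP; rewrite /= /hrank rk_polar.
by rewrite -subzn // [X in _ - X]addrAC opprB addrCA.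
Qed.

End HalvedCube.

Theorem corollary3p5 (m : nat) (hm3 : 3 <= m) (hodd : odd m) :
  exists P : polytope 3,
    [/\ regular P, self_dual P, has_schlafli_type P [:: m; m] &
        #|flags P| = 2 ^ m * m].
Proof.
case: m hm3 hodd => [|[|[|n]]] // _ _; exists (halved_cube n); split.
- exact: halved_cube_regular.
- exact: halved_cube_self_dual.
- exact: halved_cube_type.
- exact: card_flags.
Qed.
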